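(* Let $p$ be a prime, let $h>0$ be an integer, let $q=p^h$, and let $i$ be a power of $p$. There is a polynomial $C_i$ in several variables with coefficients in $\mathbb{F}_p$ such that the following holds: whenever $F=\sum f_{k\ell}X^kY^\ell$ and $F'=\sum f'_{k\ell}X^kY^\ell$ are formal group laws of height $h$ over an integral domain $R$ of characteristic $p$ and $U=\sum_j u_j\tau^j$ is a homomorphism from $F$ to $F'$, then $$v'_1u_i^q-v_1^iu_i=C_i\bigl(u_j,f_{k\ell},f'_{k\ell}\;\big|\;j<i,\ k+\ell\le qi\bigr),$$ where $v_1,v'_1$ are the first nonzero coefficients of the power series $[p]_F$, $[p]_{F'}$ respectively.
   Context: A formal group law over $R$ is $F\in R[[X,Y]]$ with $F(X,0)=X$, $F(X,Y)=F(Y,X)$, $F(F(X,Y),Z)=F(X,F(Y,Z))$; a homomorphism $F\to F'$ is $U\in\tau R[[\tau]]$ with $U(F(X,Y))=F'(U(X),U(Y))$. $[p]_F$ is defined by $[1]=\tau$, $[n+1]=F([n]\tau,\tau)$. The height of a power series $U$ is the largest $h$ such that $U(\tau)=V(\tau^{p^h})$ for some power series $V$ ($\infty$ if $U=0$); the height of $F$ is the height of $[p]_F$. *)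

(* Defs.v *)
From HB Require Import structures.
From mathcomp Require Import all_boot all_order all_algebra.
From mathcomp.multinomials Require Import mpoly.

Set Implicit Arguments.
Unset Strict Implicit.
Unset Printing Implicit Defensive.

Import GRing.Theory.
Local Open Scope ring_scope.

(* R[[X_0, ..., X_(n-1)]], as families of coefficients indexed by monomials. *)
Definition series (R : Type) (n : nat) : Type := 'X_{1..n} -> R.

Section Series.
Variable R : comNzRingType.

Definition smonom n (a : 'X_{1..n}) : series R n := fun m => (m == a)%:R.

Definition svar n (i : 'I_n) : series R n := smonom U_(i)%MM.

(* The polynomial made of the terms of f of total degree at most d. *)
Definition strunc n (d : nat) (f : series R n) : {mpoly R[n]} :=
  \sum_(a : 'X_{1..n < d.+1}) f a *: 'X_[a].

(* The substitution f(g_0, ..., g_(k-1)). When the g_i have no constant term,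
   the coefficient of a monomial of degree d in it depends only on the terms
   of degree at most d of f and of the g_i, so it is read off the composition
   of the truncations. Not meaningful if some g_i has a constant term. *)
Definition scomp k n (f : series R k) (g : k.-tuple (series R n)) :
    series R n :=
  fun m => (strunc (mdeg m) f \mPo
              [tuple strunc (mdeg m) (tnth g i) | i < k])@_m.

(* The variable tau of R[[tau]], and the coefficient of tau^j. *)
Definition stau : series R 1 := svar ord0.

Definition scoef (U : series R 1) (j : nat) : R := U [multinom j | _ < 1].

Definition fgl_assoc (F : series R 2) : Prop :=
  let X := svar (inord 0 : 'I_3) in
  let Y := svar (inord 1 : 'I_3) in
  let Z := svar (inord 2 : 'I_3) in
  scomp F [tuple scomp F [tuple X; Y]; Z] =1
  scomp F [tuple X; scomp F [tuple Y; Z]].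

Definition is_fgl (F : series R 2) : Prop :=
  [/\ scomp F [tuple stau; fun=> 0] =1 stau,
      F =1 scomp F [tuple svar (inord 1); svar (inord 0)]
    & fgl_assoc F].

Definition is_fgl_hom (F F' : series R 2) (U : series R 1) : Prop :=
  let X := svar (inord 0 : 'I_2) in
  let Y := svar (inord 1 : 'I_2) in
  scoef U 0 = 0 /\
  scomp U [tuple F] =1 scomp F' [tuple scomp U [tuple X]; scomp U [tuple Y]].

(* [n]_F; the value 0 at n = 0 is the usual convention. *)
Fixpoint fgl_nmul (F : series R 2) (n : nat) : series R 1 :=
  match n with
  | 0 => fun=> 0
  | 1 => stau
  | n'.+1 => scomp F [tuple fgl_nmul F n'; stau]
  end.

(* U(tau) = V(tau^d) for some power series V. *)
Definition series_in_power (d : nat) (U : series R 1) : Prop :=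
  exists V : series R 1,
    U =1 scomp V [tuple smonom [multinom d | _ < 1]].

(* The height of U is the finite number h; this fails for every h if U = 0. *)
Definition series_height (p : nat) (U : series R 1) (h : nat) : Prop :=
  series_in_power (p ^ h) U /\
  forall h', series_in_power (p ^ h') U -> (h' <= h)%N.

Definition fgl_height (p : nat) (F : series R 2) (h : nat) : Prop :=
  series_height p (fgl_nmul F p) h.

Definition first_nonzero_coef (U : series R 1) (v : R) : Prop :=
  exists n, [/\ scoef U n = v, v != 0
             & forall m, (m < n)%N -> scoef U m = 0].

End Series.

(* Indices of the variables u_j (j < i), f_kl and f'_kl (k + l <= d). *)
Definition cvars (i d : nat) : finType :=
  ('I_i + 'X_{1..2 < d.+1} + 'X_{1..2 < d.+1})%type.

Definition cvars_val (R : comNzRingType) (i d : nat)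
    (U : series R 1) (F F' : series R 2) (x : cvars i d) : R :=
  match x with
  | inl (inl j) => scoef U j
  | inl (inr m) => F m
  | inr m => F' m
  end.

(* Evaluation in a ring of characteristic p of a polynomial over F_p, the
   map from F_p to R being a |-> a%:R. *)
Definition Fp_eval (p : nat) (T : finType) (R : comNzRingType)
    (C : {mpoly 'F_p[#|T|]}) (v : T -> R) : R :=
  mmap (fun a : 'F_p => (a : nat)%:R) (fun k => v (enum_val k)) C.

(* Main.v *)
Require Import Defs.
From HB Require Import structures.
From mathcomp Require Import all_boot all_order all_algebra.
From mathcomp.multinomials Require Import mpoly.

(* A homomorphism commutes with multiplication by p: U([p]_F) = [p]_F'(U). In
   characteristic p and height h, the series [p]_F and [p]_F' are series in
   tau^q with leading terms v_1 tau^q and v'_1 tau^q. Let V be the part of U of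
   degree < i. Then U([p]_F) and V([p]_F) differ at tau^(q i) by v_1^i u_i,
   while [p]_F'(U) and [p]_F'(V) differ there by v'_1 u_i^q, because
   U^q = V^q + u_i^q tau^(q i) + (higher order terms). So C_i is the
   coefficient of tau^(q i) in V([p]_F) - [p]_F'(V); it involves only the u_j
   with j < i and the coefficients of F and F' of degree at most q i.

   That the leading term of [p]_F sits exactly at tau^q comes from the
   coefficient of X^(q (k - 1)) Y^q in [p]_F(F(X, Y)) = F([p]_F X, [p]_F Y): if
   [p]_F had no term in tau^q, it would give k v_k = 0 for every k, so that
   [p]_F would be a series in tau^(p q). *)

Set Implicit Arguments.
Unset Strict Implicit.
Unset Printing Implicit Defensive.

Import GRing.Theory.
Local Open Scope ring_scope.

(** * Congruence of polynomials in low degrees *)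

Section Congruence.
Variables (R : comNzRingType) (n : nat) (phi : 'X_{1..n} -> nat).
Implicit Types (f g : {mpoly R[n]}) (d e : nat).

(* The weight phi is the total degree, or the degree in one variable. *)
Definition eqlow d f g := forall m, (phi m < d)%N -> f@_m = g@_m.

Lemma eqlow_refl d f : eqlow d f f.
Proof. by []. Qed.

Lemma eqlow_sym d f g : eqlow d f g -> eqlow d g f.
Proof. by move=> fg m /fg. Qed.

Lemma eqlow_trans d g f h : eqlow d f g -> eqlow d g h -> eqlow d f h.
Proof. by move=> fg gh m lt_m; rewrite fg ?gh. Qed.

Lemma eqlow_le d e f g : (e <= d)%N -> eqlow d f g -> eqlow e f g.
Proof. by move=> le_ed fg m lt_m; apply: fg; apply: leq_trans le_ed. Qed.

Lemma eqlow_sub d f g : eqlow d f g <-> eqlow d (f - g) 0.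
Proof.
split=> fg m /fg; rewrite mcoeffB mcoeff0; first by move->; rewrite subrr.
by move/subr0_eq.
Qed.

Lemma eqlowD d f f' g g' :
  eqlow d f f' -> eqlow d g g' -> eqlow d (f + g) (f' + g').
Proof. by move=> ff gg m lt_m; rewrite !mcoeffD ff ?gg. Qed.

Lemma eqlowZ d c f f' : eqlow d f f' -> eqlow d (c *: f) (c *: f').
Proof. by move=> ff m lt_m; rewrite !mcoeffZ ff. Qed.

Lemma eqlow_sum d (I : eqType) (r : seq I) (F G : I -> {mpoly R[n]}) :
  (forall i, i \in r -> eqlow d (F i) (G i)) ->
  eqlow d (\sum_(i <- r) F i) (\sum_(i <- r) G i).
Proof.
move=> FG m lt_m; rewrite !raddf_sum /=.
by apply: eq_big_seq => i /FG ->.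
Qed.

Lemma eqlow_sum0 d (I : eqType) (r : seq I) (F : I -> {mpoly R[n]}) :
  (forall i, i \in r -> eqlow d (F i) 0) -> eqlow d (\sum_(i <- r) F i) 0.
Proof.
move=> F0 m lt_m; rewrite raddf_sum mcoeff0 big_seq big1 // => i /F0 Fi0 /=.
by rewrite Fi0 ?mcoeff0.
Qed.

Hypothesis phiD : {morph phi : a b / (a + b)%MM >-> (a + b)%N}.

Lemma eqlowM d f f' g g' :
  eqlow d f f' -> eqlow d g g' -> eqlow d (f * g) (f' * g').
Proof.
move=> ff gg m lt_m; rewrite !mcoeffM; apply: eq_bigr => k /eqP mE.
have {lt_m} := lt_m; rewrite [in phi _]mE phiD => lt_m.
rewrite ff ?gg //; apply: leq_trans lt_m; rewrite ltnS ?leq_addl ?leq_addr //.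
Qed.

Lemma eqlowM0 d e f g :
  eqlow d f 0 -> eqlow e g 0 -> eqlow (d + e) (f * g) 0.
Proof.
move=> f0 g0 m lt_m; rewrite mcoeffM mcoeff0 big1 // => k /eqP mE.
have {lt_m} := lt_m; rewrite [in phi _]mE phiD.
case: (ltnP (phi k.1) d) => [/f0 -> _|le_d]; first by rewrite mcoeff0 mul0r.
case: (ltnP (phi k.2) e) => [/g0 -> _|le_e]; first by rewrite mcoeff0 mulr0.
by rewrite ltnNge leq_add.
Qed.

Lemma eqlowX d f f' k : eqlow d f f' -> eqlow d (f ^+ k) (f' ^+ k).
Proof.
move=> ff; elim: k => [|k IHk]; first exact: eqlow_refl.
by rewrite !exprS; apply: eqlowM.
Qed.

Lemma eqlowX0 d f k : eqlow d f 0 -> eqlow (d * k) (f ^+ k) 0.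
Proof.
move=> f0; elim: k => [|k IHk]; first by rewrite muln0.
by rewrite mulnS exprS; apply: eqlowM0.
Qed.

Lemma eqlow_prod d k (F G : 'I_k -> {mpoly R[n]}) :
  (forall i, eqlow d (F i) (G i)) -> eqlow d (\prod_i F i) (\prod_i G i).
Proof.
move=> FG; apply: (big_ind2 (eqlow d)) => // *; exact: eqlowM.
Qed.

Lemma eqlow_compr d k (f : {mpoly R[k]}) (g g' : k.-tuple {mpoly R[n]}) :
    (forall i, eqlow d (tnth g i) (tnth g' i)) ->
  eqlow d (f \mPo g) (f \mPo g').
Proof.
move=> gg; rewrite !comp_mpolyE; apply: eqlow_sum => m _.
by apply/eqlowZ/eqlow_prod => i; apply: eqlowX.
Qed.

(** Every monomial left in f has degree at least d, and each of its factors is replaced by a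
    polynomial of order at least e; orders add up in products. *)
Lemma eqlow_compl0 d e k (f : {mpoly R[k]}) (g : k.-tuple {mpoly R[n]}) :
    (forall m, (mdeg m < d)%N -> f@_m = 0) ->
    (forall i, eqlow e (tnth g i) 0) ->
  eqlow (e * d) (f \mPo g) 0.
Proof.
move=> f0 g0; rewrite comp_mpolyE; apply: eqlow_sum0 => m _.
case: (ltnP (mdeg m) d) => [/f0 ->|le_d]; first by rewrite scale0r.
rewrite -[X in eqlow _ _ X](scaler0 _ f@_m); apply: eqlowZ.
apply: (@eqlow_le (e * mdeg m)); first by rewrite leq_mul2l le_d orbT.
rewrite mdegE big_distrr /=.
elim: (index_enum _) => [|i r IHr].
  by rewrite !big_nil => m'; rewrite ltn0.
by rewrite !big_cons; apply: eqlowM0 => //; apply: eqlowX0.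
Qed.

End Congruence.

Arguments eqlow_refl {R n phi} d f.

Notation eqdeg := (eqlow (@mdeg _)).

Section CongruenceDeg.
Variable R : comNzRingType.

(** The inner polynomials are replaced first, which preserves any congruence. The outer one comes
    next: the terms of f - f' have degree at least d, and they keep order at least d because the
    inner polynomials have no constant term. *)
Lemma eqdeg_comp d k n (f f' : {mpoly R[k]}) (g g' : k.-tuple {mpoly R[n]}) :
    eqdeg d f f' -> (forall i, eqdeg d (tnth g i) (tnth g' i)) ->
    (forall i, eqdeg 1 (tnth g i) 0) ->
  eqdeg d (f \mPo g) (f' \mPo g').
Proof.
move=> ff gg g0; apply: (@eqlow_trans _ _ _ _ (f' \mPo g)); last first.
  by apply: eqlow_compr => //; apply: mdegD.
apply/eqlow_sub; rewrite -comp_mpolyB -[d]mul1n.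
apply: eqlow_compl0 => // [|m lt_m]; first exact: mdegD.
by rewrite mcoeffB ff ?subrr.
Qed.

Lemma comp_mpolyA k l n (f : {mpoly R[k]}) (g : k.-tuple {mpoly R[l]})
    (h : l.-tuple {mpoly R[n]}) :
  (f \mPo g) \mPo h = f \mPo [tuple tnth g i \mPo h | i < k].
Proof.
rewrite [f \mPo g]comp_mpolyE [RHS]comp_mpolyE raddf_sum /=.
apply: eq_bigr => m _; rewrite comp_mpolyZ rmorph_prod.
congr (_ *: _); apply: eq_bigr => i _.
by rewrite rmorphXn tnth_mktuple.
Qed.

Lemma map_mpoly_comp_mpoly (S : comNzRingType) (phi : {rmorphism R -> S}) k n
    (f : {mpoly R[k]}) (g : k.-tuple {mpoly R[n]}) :
  map_mpoly phi (f \mPo g) =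
  map_mpoly phi f \mPo [tuple map_mpoly phi (tnth g i) | i < k].
Proof.
rewrite (comp_mpolyE f) [in RHS](mpolyE f) !(raddf_sum (map_mpoly phi)).
rewrite raddf_sum /=; apply: eq_bigr => m _.
rewrite !map_mpolyZ map_mpolyX comp_mpolyZ comp_mpolyX rmorph_prod.
congr (_ *: _); apply: eq_bigr => i _.
by rewrite rmorphXn tnth_mktuple.
Qed.

(** The bridge from series to polynomials: [scomp] is given coefficient by coefficient, whereas
    polynomial composition is associative. Through [approx], identities of series become congruences
    of polynomials. *)
Definition approx n d (f : series R n) (P : {mpoly R[n]}) :=
  forall m, (mdeg m < d)%N -> f m = P@_m.

Lemma mcoeff_strunc n d (f : series R n) m :
  (strunc d f)@_m = if (mdeg m <= d)%N then f m else 0.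
Proof.
case: leqP => [le_d|lt_d]; first by rewrite mcoeff_mpoly.
rewrite raddf_sum big1 // => a _ /=; rewrite mcoeffZ mcoeffX.
case: eqP => [am|_]; last by rewrite mulr0.
by have := bmdeg a; rewrite am ltnS leqNgt lt_d.
Qed.

Lemma approx_strunc n d (f : series R n) : approx d.+1 f (strunc d f).
Proof. by move=> m; rewrite ltnS mcoeff_strunc => ->. Qed.

Lemma approx_strunc_pred n d (f : series R n) : approx d f (strunc d f).
Proof. by move=> m; rewrite mcoeff_strunc => /ltnW ->. Qed.

Lemma approx_eqdeg n d (f f' : series R n) P P' :
  approx d f P -> approx d f' P' -> f =1 f' -> eqdeg d P P'.
Proof. by move=> fP fP' ff m lt_m; rewrite -fP // -fP' // ff. Qed.

Lemma approx_svar n d (i : 'I_n) : approx d (svar R i) 'X_i.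
Proof. by move=> m _; rewrite mcoeffX /svar /smonom eq_sym. Qed.

Lemma approx0 n d : approx d ((fun=> 0) : series R n) 0.
Proof. by move=> m _; rewrite mcoeff0. Qed.

(** At a monomial m, [scomp] composes truncations at degree [mdeg m]. For [mdeg m] below d these
    agree with P and Q in all degrees up to [mdeg m], so [eqdeg_comp] applies. *)
Lemma approx_scomp k n d (f : series R k) P (g : k.-tuple (series R n))
    (Q : k.-tuple {mpoly R[n]}) :
    approx d f P -> (forall i, approx d (tnth g i) (tnth Q i)) ->
    (forall i, eqdeg 1 (tnth Q i) 0) ->
  approx d (scomp f g) (P \mPo Q).
Proof.
move=> fP gQ Q0 m lt_m; rewrite /scomp.
have := @eqdeg_comp (mdeg m).+1 k n P (strunc (mdeg m) f) Q
  [tuple strunc (mdeg m) (tnth g i) | i < k].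
move=> -> //.
- move=> a; rewrite ltnS => le_a; rewrite mcoeff_strunc le_a fP //.
  exact: leq_ltn_trans lt_m.
- move=> i a; rewrite ltnS => le_a.
  rewrite tnth_mktuple mcoeff_strunc le_a gQ //.
  exact: leq_ltn_trans lt_m.
Qed.

Lemma eqdegX1 n (i : 'I_n) : eqdeg 1 ('X_i : {mpoly R[n]}) 0.
Proof.
move=> m; rewrite ltnS leqn0 mdeg_eq0 => /eqP ->.
by rewrite mcoeffX mcoeff0 mnm1_eq0.
Qed.

Lemma eqdeg1_tnth1 n (a : {mpoly R[n]}) :
  eqdeg 1 a 0 -> forall i, eqdeg 1 (tnth [tuple a] i) 0.
Proof. by move=> a0; case=> [[|//] lt_i]. Qed.

Lemma eqdeg1_tnth2 n (a b : {mpoly R[n]}) :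
  eqdeg 1 a 0 -> eqdeg 1 b 0 -> forall i, eqdeg 1 (tnth [tuple a; b] i) 0.
Proof. by move=> a0 b0; case=> [[|[|//]] lt_i]. Qed.

Lemma forall_tnth2 (T S : Type) (P : T -> S -> Prop) a b a' b' :
  P a a' -> P b b' -> forall i, P (tnth [tuple a; b] i) (tnth [tuple a'; b'] i).
Proof. by move=> Pa Pb; case=> [[|[|//]] lt_i]. Qed.

Lemma forall_tnth1 (T S : Type) (P : T -> S -> Prop) a a' :
  P a a' -> forall i, P (tnth [tuple a] i) (tnth [tuple a'] i).
Proof. by move=> Pa; case=> [[|//] lt_i]. Qed.

End CongruenceDeg.

(** * Formal group laws up to a given degree *)

Section FormalSum.
Variable R : comNzRingType.
Implicit Types (F : {mpoly R[2]}) (D : nat).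

Definition padd F n (a b : {mpoly R[n]}) := F \mPo [tuple a; b].

Lemma padd_comp F k n (a b : {mpoly R[k]}) (t : k.-tuple {mpoly R[n]}) :
  padd F a b \mPo t = padd F (a \mPo t) (b \mPo t).
Proof.
rewrite /padd comp_mpolyA; congr (_ \mPo _).
by apply: eq_from_tnth => -[[|[|//]] lt_i]; rewrite tnth_mktuple.
Qed.

Lemma eqdeg_padd F D n (a a' b b' : {mpoly R[n]}) :
  eqdeg D a a' -> eqdeg D b b' -> eqdeg D (padd F a b) (padd F a' b').
Proof.
move=> aa bb; apply: eqlow_compr; first exact: mdegD.
exact: (forall_tnth2 (P := eqdeg D)).
Qed.

Lemma eqdeg1_comp k n (f : {mpoly R[k]}) (t : k.-tuple {mpoly R[n]}) :
  eqdeg 1 f 0 -> (forall i, eqdeg 1 (tnth t i) 0) -> eqdeg 1 (f \mPo t) 0.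
Proof.
move=> f0 t0; rewrite -[X in eqlow _ X]mul1n; apply: eqlow_compl0 => //.
  exact: mdegD.
by move=> m /f0 ->; rewrite mcoeff0.
Qed.

Lemma eqdeg1_padd F n (a b : {mpoly R[n]}) :
  eqdeg 1 F 0 -> eqdeg 1 a 0 -> eqdeg 1 b 0 -> eqdeg 1 (padd F a b) 0.
Proof. by move=> F0 a0 b0; apply: eqdeg1_comp => //; apply: eqdeg1_tnth2. Qed.

(* The multiplication by n + 1, not by n. *)
Fixpoint pnmul F n : {mpoly R[1]} :=
  if n is n'.+1 then padd F (pnmul F n') 'X_ord0 else 'X_ord0.

Lemma eqdeg1_pnmul F n : eqdeg 1 F 0 -> eqdeg 1 (pnmul F n) 0.
Proof.
move=> F0; elim: n => [|n IHn] /=; first exact: eqdegX1.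
by apply: eqdeg1_padd => //; apply: eqdegX1.
Qed.

Lemma approx_padd (F : series R 2) P D n (f g : series R n) a b :
    approx D F P -> approx D f a -> approx D g b ->
    eqdeg 1 a 0 -> eqdeg 1 b 0 ->
  approx D (scomp F [tuple f; g]) (padd P a b).
Proof.
move=> FP fa gb a0 b0; apply: approx_scomp => //.
  exact: (forall_tnth2 (P := approx D)).
exact: eqdeg1_tnth2.
Qed.

Lemma approx_fgl_nmul (F : series R 2) P D n :
  approx D F P -> eqdeg 1 P 0 -> approx D (fgl_nmul F n.+1) (pnmul P n).
Proof.
move=> FP P0; elim: n => [|n IHn] /=; first exact: approx_svar.
apply: approx_padd => //; first exact: approx_svar.
  exact: eqdeg1_pnmul.
exact: eqdegX1.
Qed.

(** The vanishing of the constant term is listed apart because substitution into a congruence relies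
    on it even when D is 0. *)
Definition fgl_upto D F :=
  [/\ eqdeg 1 F 0,
      eqdeg D (padd F 'X_(ord0 : 'I_1) 0) 'X_ord0,
      eqdeg D F (padd F 'X_(inord 1 : 'I_2) 'X_(inord 0))
    & eqdeg D (padd F (padd F 'X_(inord 0 : 'I_3) 'X_(inord 1)) 'X_(inord 2))
              (padd F 'X_(inord 0) (padd F 'X_(inord 1) 'X_(inord 2)))].

(** F and F(X, 0) have the same constant term, and F(X, 0) = X. *)
Lemma eqdeg1_fgl (F : series R 2) D : is_fgl F -> eqdeg 1 (strunc D F) 0.
Proof.
case=> /(_ 0%MM) F0 _ _ m; rewrite ltnS leqn0 mdeg_eq0 => /eqP ->.
rewrite mcoeff_strunc mcoeff0 mdeg0 leq0n.
have F1 : approx 1 F (F 0%MM)%:MP.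
  move=> a; rewrite ltnS leqn0 mdeg_eq0 => /eqP ->.
  by rewrite mcoeffC eqxx mulr1.
have := approx_padd F1 (@approx_svar R 1 1 ord0) (@approx0 R 1 1)
  (@eqdegX1 R 1 ord0) (eqlow_refl 1 0) (m := 0%MM).
rewrite mdeg0 => /(_ isT); rewrite [LHS]F0 /padd comp_mpolyC mcoeffC eqxx mulr1.
by rewrite /stau /svar /smonom eq_sym mnm1_eq0 => <-.
Qed.

Lemma fgl_upto_strunc (F : series R 2) D :
  is_fgl F -> fgl_upto D (strunc D F).
Proof.
move=> Ffgl; have F0 := eqdeg1_fgl D Ffgl.
have FD := @approx_strunc_pred R 2 D F.
have X0 n (i : 'I_n) := @eqdegX1 R n i.
have XD n (i : 'I_n) := @approx_svar R n D i.
case: Ffgl => Fid Fcomm Fassoc; split; first exact: F0.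
- apply: approx_eqdeg Fid; last exact: XD.
  exact: approx_padd FD (XD _ _) (@approx0 _ _ _) (X0 _ _) (eqlow_refl 1 0).
- apply: approx_eqdeg Fcomm; first exact: FD.
  exact: approx_padd FD (XD _ _) (XD _ _) (X0 _ _) (X0 _ _).
- have padd_var (i j : 'I_3) :=
    approx_padd FD (XD _ i) (XD _ j) (X0 _ i) (X0 _ j).
  have padd_var0 (i j : 'I_3) := eqdeg1_padd F0 (X0 _ i) (X0 _ j).
  apply: approx_eqdeg Fassoc.
    exact: approx_padd FD (padd_var _ _) (XD _ _) (padd_var0 _ _) (X0 _ _).
  exact: approx_padd FD (XD _ _) (padd_var _ _) (X0 _ _) (padd_var0 _ _).
Qed.

Section Laws.
Variables (D : nat) (F : {mpoly R[2]}) (F_fgl : fgl_upto D F).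
Variable n : nat.
Implicit Types a b c d : {mpoly R[n]}.

(** Like [paddA] and [padd0] below, this comes from substituting the arguments for the variables in
    the corresponding axiom. *)
Lemma paddC a b : eqdeg 1 a 0 -> eqdeg 1 b 0 ->
  eqdeg D (padd F a b) (padd F b a).
Proof.
case: F_fgl => _ _ Fcomm _ a0 b0.
have := eqdeg_comp Fcomm (fun i => eqlow_refl D (tnth [tuple a; b] i))
  (eqdeg1_tnth2 a0 b0).
by rewrite padd_comp !comp_mpolyXU !inordK.
Qed.

Lemma paddA a b c : eqdeg 1 a 0 -> eqdeg 1 b 0 -> eqdeg 1 c 0 ->
  eqdeg D (padd F (padd F a b) c) (padd F a (padd F b c)).
Proof.
case: F_fgl => _ _ _ Fassoc a0 b0 c0.
have t0 i : eqdeg 1 (tnth [tuple a; b; c] i) 0 by case: i => [[|[|[|//]]] lt_i].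
have := eqdeg_comp Fassoc (fun i => eqlow_refl D (tnth _ i)) t0.
by rewrite !padd_comp !comp_mpolyXU !inordK.
Qed.

Lemma padd0 a : eqdeg 1 a 0 -> eqdeg D (padd F a 0) a.
Proof.
case: F_fgl => _ Fid _ _ a0.
have := eqdeg_comp Fid (fun i => eqlow_refl D (tnth [tuple a] i))
  (eqdeg1_tnth1 a0).
by rewrite padd_comp !comp_mpolyXU comp_mpoly0.
Qed.

Lemma paddACA a b c d :
    eqdeg 1 a 0 -> eqdeg 1 b 0 -> eqdeg 1 c 0 -> eqdeg 1 d 0 ->
  eqdeg D (padd F (padd F a b) (padd F c d)) (padd F (padd F a c) (padd F b d)).
Proof.
have [F0 _ _ _] := F_fgl; move=> a0 b0 c0 d0.
have s0 x y := @eqdeg1_padd F n x y F0.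
apply: eqlow_trans (paddA _ _ _) _; [by auto.. |].
apply: eqlow_trans (eqlow_sym (paddA _ _ _)); [|by auto..].
apply: eqdeg_padd; first exact: eqlow_refl.
apply: eqlow_trans (eqlow_sym (paddA _ _ _)) _; [by auto.. |].
apply: eqlow_trans (paddA _ _ _); [|by auto..].
by apply: eqdeg_padd; [apply: paddC | apply: eqlow_refl].
Qed.

End Laws.

(** Induction on k. The step regroups four summands by [paddACA], which is where commutativity of
    the law enters. *)
Lemma pnmul_padd D F (F_fgl : fgl_upto D F) n k (a b : {mpoly R[n]}) :
    eqdeg 1 a 0 -> eqdeg 1 b 0 ->
  eqdeg D (pnmul F k \mPo [tuple padd F a b])
    (padd F (pnmul F k \mPo [tuple a]) (pnmul F k \mPo [tuple b])).
Proof.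
move=> a0 b0; have [F0 _ _ _] := F_fgl.
elim: k => [|k IHk]; first by rewrite !comp_mpolyXU; apply: eqlow_refl.
rewrite /= !padd_comp !comp_mpolyXU /=.
have P0 (c : {mpoly R[n]}) : eqdeg 1 c 0 ->
    eqdeg 1 (pnmul F k \mPo [tuple c]) 0.
  move=> c0; apply: eqdeg1_comp; first exact: eqdeg1_pnmul.
  exact: eqdeg1_tnth1.
apply: eqlow_trans (paddACA F_fgl (P0 a a0) (P0 b b0) a0 b0).
exact: eqdeg_padd IHk (eqlow_refl _ _).
Qed.

(** The induction step substitutes [k+1]_F(tau) for X and tau for Y in the homomorphism
    congruence. *)
Lemma pnmul_hom D F F' (U : {mpoly R[1]}) k :
    eqdeg 1 F 0 -> eqdeg 1 F' 0 -> eqdeg 1 U 0 ->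
    eqdeg D (U \mPo [tuple F])
      (padd F' (U \mPo [tuple 'X_(inord 0 : 'I_2)])
               (U \mPo [tuple 'X_(inord 1)])) ->
  eqdeg D (U \mPo [tuple pnmul F k]) (pnmul F' k \mPo [tuple U]).
Proof.
move=> F0 F0' U0 Uhom; elim: k => [|k IHk].
  rewrite /= comp_mpolyXU /= -[X in eqlow _ _ _ X]comp_mpoly_id.
  apply: eqlow_compr; first exact: mdegD.
  move=> i; rewrite tnth_mktuple !ord1; exact: eqlow_refl.
rewrite /= padd_comp comp_mpolyXU /=.
have P0 := @eqdeg1_pnmul F k F0.
have := eqdeg_comp Uhom
  (fun i => eqlow_refl D (tnth [tuple pnmul F k; 'X_ord0] i))
  (eqdeg1_tnth2 P0 (@eqdegX1 R 1 ord0)).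
rewrite padd_comp !comp_mpolyA => UP.
have e (x : {mpoly R[2]}) t :
   [tuple tnth [tuple x] i \mPo t | i < 1] = [tuple (x \mPo t) : {mpoly R[1]}].
  by apply: eq_from_tnth => i; rewrite tnth_mktuple ord1.
rewrite !e !comp_mpolyXU !inordK //= in UP.
apply: eqlow_trans UP _; apply: eqdeg_padd => //.
rewrite -[X in eqlow _ _ _ X]comp_mpoly_id; apply: eqlow_compr.
  exact: mdegD.
by move=> i; rewrite tnth_mktuple !ord1; apply: eqlow_refl.
Qed.

End FormalSum.

(** * The leading term of multiplication by p *)

Notation mon j := [multinom j | _ < 1].

Lemma mdeg_mon j : mdeg (mon j) = j.
Proof. by rewrite mdegE big_ord1 mnmE. Qed.

Lemma mon_mdeg (m : 'X_{1..1}) : mon (mdeg m) = m.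
Proof. by apply/mnmP => i; rewrite mnmE mdegE big_ord1 [i]ord1. Qed.

Lemma eq_mon j k : (mon j == mon k) = (j == k).
Proof.
by apply/eqP/eqP => [/(congr1 (@mdeg 1))|->//]; rewrite !mdeg_mon.
Qed.

Section OneVariable.
Variable R : comNzRingType.

Lemma comp_mpoly1E n (P : {mpoly R[1]}) (Q : {mpoly R[n]}) :
  P \mPo [tuple Q] = \sum_(m <- msupp P) P@_m *: Q ^+ mdeg m.
Proof.
by rewrite comp_mpolyE; apply: eq_bigr => m _; rewrite big_ord1 mdegE big_ord1.
Qed.

Lemma mcoeff_comp_Xn d (P : {mpoly R[1]}) j : (0 < d)%N ->
  (P \mPo [tuple 'X_[mon d]])@_(mon j) =
  if (d %| j)%N then P@_(mon (j %/ d)) else 0.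
Proof.
move=> d_gt0; rewrite comp_mpoly1E [in P@_(mon _)](mpolyE P) !raddf_sum /=.
have e (m : 'X_{1..1}) : (mon d *+ mdeg m)%MM = mon (d * mdeg m).
  by apply/mnmP => i; rewrite mulmnE !mnmE.
case: ifP => [/dvdnP[k ->]|ndvd].
  rewrite mulnK //; apply: eq_bigr => m _; rewrite !mcoeffZ mpolyXn !mcoeffX e.
  by rewrite eq_mon mulnC eqn_pmul2r // -[in RHS](mon_mdeg m) eq_mon mon_mdeg.
rewrite big1 // => m _; rewrite !mcoeffZ mpolyXn !mcoeffX e.
rewrite eq_mon; case: eqP => [jE|_]; last by rewrite mulr0.
by rewrite -jE dvdn_mulr in ndvd.
Qed.

Lemma scoef_scomp_power d (V : series R 1) j : (0 < d)%N ->
  scoef (scomp V [tuple smonom R (mon d)]) j =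
  if (d %| j)%N then scoef V (j %/ d) else 0.
Proof.
move=> d_gt0; rewrite /scoef.
have VP := @approx_strunc R 1 j V.
have dX : approx j.+1 (smonom R (mon d)) 'X_[mon d].
  by move=> m _; rewrite mcoeffX /smonom eq_sym.
have d0 : eqdeg 1 ('X_[mon d] : {mpoly R[1]}) 0.
  move=> m; rewrite ltnS leqn0 mcoeffX mcoeff0 -{2}(mon_mdeg m) => /eqP ->.
  by rewrite eq_mon gtn_eqF.
rewrite (approx_scomp VP (forall_tnth1 (P := approx j.+1) dX)
  (eqdeg1_tnth1 d0)) ?mdeg_mon //.
rewrite mcoeff_comp_Xn //; case: ifP => // _.
by rewrite mcoeff_strunc mdeg_mon leq_div.
Qed.

Lemma series_in_powerP d (U : series R 1) : (0 < d)%N ->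
  series_in_power d U <-> forall j, ~~ (d %| j)%N -> scoef U j = 0.
Proof.
move=> d_gt0; split=> [[V UV] j /negbTE ndvd | U0].
  by rewrite /scoef UV [LHS]scoef_scomp_power // ndvd.
exists (fun m => scoef U (d * mdeg m)) => m; rewrite -(mon_mdeg m).
rewrite [RHS]scoef_scomp_power // /scoef mdeg_mon.
by case: ifP => [/divnK|/negbT/U0//]; rewrite mulnC => ->.
Qed.

End OneVariable.

(** * Powers with exponent q in characteristic p *)

Section Frobenius.
Variables (R : comNzRingType) (n : nat).

Lemma pnat_pchar_mpoly q : [pchar R].-nat q -> [pchar {mpoly R[n]}].-nat q.
Proof. by apply: sub_in_pnat => p _; apply: (rmorph_pchar (@mpolyC n R)). Qed.

(** The hypothesis [[pchar R].-nat q] makes q a power of the characteristic (possibly 1). Raising to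
    the power q is then additive, so f^q is a sum of q-th powers of terms. *)
Lemma mcoeff_exp_pchar q (f : {mpoly R[n]}) (m : 'X_{1..n}) i :
  [pchar R].-nat q -> ~~ (q %| m i)%N -> (f ^+ q)@_m = 0.
Proof.
move=> q_nat ndvd; rewrite [f]mpolyE.
elim/big_rec: _ => [|a g _ g0].
  by rewrite expr0n gtn_eqF ?mcoeff0 //; case/andP: q_nat.
rewrite exprDn_pchar ?pnat_pchar_mpoly // mcoeffD g0 addr0.
rewrite exprZn mpolyXn mcoeffZ mcoeffX.
case: eqP => [mE|_]; last by rewrite mulr0.
by rewrite -mE mulmnE dvdn_mull in ndvd.
Qed.

End Frobenius.

Section LeadingCoefficient.
Variable R : comNzRingType.
Implicit Types F : {mpoly R[2]}.

(** Here (X + Y)^(q k) = (X^q + Y^q)^k, and k is the binomial coefficient of (X^q)^(k-1) Y^q. *)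
Lemma mcoeff_mixed_exp q k (X := 'X_(inord 0) : {mpoly R[2]})
    (Y := 'X_(inord 1) : {mpoly R[2]}) : [pchar R].-nat q -> (0 < k)%N ->
  ((X + Y) ^+ (q * k))@_(U_(inord 0) *+ (q * k.-1) + U_(inord 1) *+ q) = k%:R.
Proof.
move=> q_nat k_gt0; have q_gt0 : (0 < q)%N by case/andP: q_nat.
rewrite exprM exprDn_pchar ?pnat_pchar_mpoly // exprDn raddf_sum /=.
have lt1 : (1 < k.+1)%N by [].
rewrite (bigD1 (Ordinal lt1)) //= big1 => [|i i_neq1].
  rewrite addr0 -exprM expr1 subn1 /X /Y !mpolyXn -mpolyXD mcoeffMn mcoeffX.
  by rewrite eqxx bin1.
rewrite /X /Y -!exprM !mpolyXn -mpolyXD mcoeffMn mcoeffX.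
case: eqP => [/mnmP/(_ (inord 1))|_]; last by rewrite mul0rn.
rewrite !mnmDE !mulmnE !mnm1E eqxx -val_eqE /= !inordK //= !mul0n !add0n !mul1n.
move/eqP; rewrite -{2}[q]muln1 eqn_pmul2l // => /eqP i1.
by case/eqP: i_neq1; apply: val_inj.
Qed.

(** In a product of k factors of order at least d, only their terms of degree d reach degree d k. *)
Lemma eqdeg_exp n d k (f g : {mpoly R[n]}) :
  eqdeg d f 0 -> eqdeg d.+1 f g -> eqdeg (d * k).+1 (f ^+ k) (g ^+ k).
Proof.
move=> f0 fg; have dD := @mdegD n.
have g0 : eqdeg d g 0.
  by apply: eqlow_trans f0; apply: eqlow_sym; apply: eqlow_le fg.
elim: k => [|k IHk]; first exact: eqlow_refl.
apply/eqlow_sub; rewrite !exprS.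
have -> : f * f ^+ k - g * g ^+ k = (f - g) * f ^+ k + g * (f ^+ k - g ^+ k).
  by rewrite mulrBl mulrBr addrA subrK.
rewrite mulnS -[X in eqlow _ _ _ X]addr0; apply: eqlowD.
  rewrite -addSn; apply: (eqlowM0 dD); last exact: eqlowX0.
  exact: (iffLR (eqlow_sub _ _ _ _) fg).
by rewrite -addnS; apply: (eqlowM0 dD g0 (iffLR (eqlow_sub _ _ _ _) IHk)).
Qed.

Lemma ord2_inord0 : inord 0 = ord0 :> 'I_2.
Proof. by apply: val_inj; rewrite /= inordK. Qed.

Lemma ord2_inord1 : inord 1 = lift ord0 ord0 :> 'I_2.
Proof. by apply: val_inj; rewrite /= inordK. Qed.

(** F(X, 0) = X forces the coefficient of X to be 1, and commutativity carries this over to Y. *)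
Lemma fgl_linear_part D F : fgl_upto D F -> (1 < D)%N ->
  eqdeg 2 F ('X_(inord 0) + 'X_(inord 1)).
Proof.
move=> F_fgl D_gt1; have [F0 _ _ _] := F_fgl.
pose a i := F@_(U_(i)); pose L := \sum_i a i *: 'X_i.
have FL : eqdeg 2 F L.
  move=> m; rewrite ltnS leq_eqVlt => /orP[/mdeg1P[i /eqP ->]|lt_m].
    rewrite raddf_sum (bigD1 i) //= big1 => [|j /negbTE ji].
      by rewrite mcoeffZ mcoeffXU eqxx mulr1 addr0.
    by rewrite mcoeffZ mcoeffXU ji mulr0.
  rewrite F0 // raddf_sum big1 ?mcoeff0 // => i _ /=.
  by rewrite mcoeffZ (eqdegX1 R i) // mcoeff0 mulr0.
have padd_lin (b c : {mpoly R[2]}) : eqdeg 1 b 0 -> eqdeg 1 c 0 ->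
    eqdeg 2 (padd F b c) (a (inord 0) *: b + a (inord 1) *: c).
  move=> b0 c0.
  have -> : a (inord 0) *: b + a (inord 1) *: c = L \mPo [tuple b; c].
    rewrite /L raddf_sum /= big_ord_recl big_ord1 -ord2_inord1 -ord2_inord0.
    by rewrite !comp_mpolyZ !comp_mpolyXU !inordK.
  apply: eqdeg_comp => //.
  exact: eqdeg1_tnth2.
have X0 i := @eqdegX1 R 2 i.
have Z0 := @eqlow_refl R 2 (@mdeg 2) 1 0.
have a1 (i : 'I_2) : eqdeg 2 (padd F 'X_i 0) 'X_i.
  exact: eqlow_le D_gt1 (padd0 F_fgl (X0 i)).
have lin (i : 'I_2) c : eqdeg 2 (c *: 'X_i) ('X_i : {mpoly R[2]}) -> c = 1.
  move/(_ U_(i)%MM); rewrite mdeg1 mcoeffZ mcoeffXU eqxx mulr1; exact.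
have a01 : a (inord 0) = 1.
  apply: (lin (inord 0)); apply: eqlow_trans (a1 _).
  apply: eqlow_sym; have := padd_lin _ _ (X0 (inord 0)) Z0.
  by rewrite scaler0 addr0.
have a11 : a (inord 1) = 1.
  apply: (lin (inord 1)); apply: eqlow_trans (a1 _).
  apply: (@eqlow_trans _ _ _ _ (padd F 0 'X_(inord 1))).
    apply: eqlow_sym; have := padd_lin _ _ Z0 (X0 (inord 1)).
    by rewrite scaler0 add0r.
  exact: eqlow_le D_gt1 (paddC F_fgl Z0 (X0 _)).
apply: eqlow_trans FL _; rewrite /L big_ord_recl big_ord1.
rewrite -ord2_inord1 -ord2_inord0.
by rewrite a01 a11 !scale1r; apply: eqlow_refl.
Qed.

(** The coefficient of M = X^(q (k-1)) Y^q is computed on both sides of P(F(X, Y)) = F(P(X), P(Y)):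
    it is k times the coefficient of tau^(q k) in P on the left, and 0 on the right. *)
Lemma endo_coef_mulrn p q k F (P : {mpoly R[1]}) :
    p \in [pchar R] -> [pchar R].-nat q -> (1 < k)%N ->
    fgl_upto (q * k).+1 F -> eqdeg 1 P 0 ->
    eqdeg (q * k).+1 (P \mPo [tuple F])
      (padd F (P \mPo [tuple 'X_(inord 0)]) (P \mPo [tuple 'X_(inord 1)])) ->
    (forall j, P@_(mon j) != 0 -> j != (q * k)%N -> (p * q %| j)%N) ->
  P@_(mon (q * k)) *+ k = 0.
Proof.
move=> p_char q_nat k_gt1 F_fgl P0 Phom Psupp.
have k_gt0 := ltnW k_gt1.
have p_gt1 := prime_gt1 (pcharf_prime p_char).
have q_gt0 : (0 < q)%N by case/andP: q_nat.
set M := (U_(inord 0 : 'I_2) *+ (q * k.-1) + U_(inord 1) *+ q)%MM.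
have M1 : M (inord 1) = q.
  by rewrite mnmDE !mulmnE !mnm1E eqxx -val_eqE /= !inordK //= mul1n.
have Mdeg : mdeg M = (q * k)%N.
  by rewrite mdegD !mdegMn !mdeg1 !mul1n addnC -mulnS prednK.
have supp m : m \in msupp P ->
    m != mon (q * k) -> (p * q %| mdeg m)%N /\ (q < mdeg m)%N.
  rewrite mcoeff_msupp => Pm m_neq.
  have dvd : (p * q %| mdeg m)%N.
    apply: Psupp; first by rewrite mon_mdeg.
    by apply: contraNneq m_neq => <-; rewrite mon_mdeg.
  split=> //; apply: (@leq_trans (p * q)); first by rewrite ltn_Pmull.
  apply: dvdn_leq => //; case: posnP Pm => // m0.
  by rewrite P0 ?m0 // mcoeff0 eqxx.
have pq_nat : [pchar R].-nat (p * q)%N.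
  by rewrite pnatM q_nat andbT pnatE ?(pcharf_prime p_char).
(* On the left only the term of P of degree q k contributes. Since F = X + Y modulo degree 2, its
   power F^(q k) has the same coefficient at M as (X + Y)^(q k), namely k. *)
have <- : (P \mPo [tuple F])@_M = P@_(mon (q * k)) *+ k.
  have -> : P@_(mon (q * k)) *+ k = P@_(mon (q * k)) * (F ^+ (q * k))@_M.
    rewrite -mulr_natr -(mcoeff_mixed_exp q_nat k_gt0) -/M; congr (_ * _).
    have [F0 _ _ _] := F_fgl.
    have lin : eqdeg 2 F ('X_(inord 0) + 'X_(inord 1)).
      by apply: (fgl_linear_part F_fgl); rewrite ltnS muln_gt0 q_gt0.
    by apply/esym/(eqdeg_exp (k := q * k) F0 lin); rewrite Mdeg mul1n.
  (* The other exponents of P are multiples of p q; all exponents in F^(p q t) are divisible by p q,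
     while Y has exponent q in M. *)
  have Fpow m : m \in msupp P -> m != mon (q * k) -> (F ^+ mdeg m)@_M = 0.
    move=> mP m_neq; have [/dvdnP[t ->] _] := supp m mP m_neq.
    rewrite exprM (@mcoeff_exp_pchar _ _ _ _ _ (inord 1)) //.
    by rewrite M1 gtnNdvd // ltn_Pmull.
  rewrite comp_mpoly1E raddf_sum /=.
  case: (boolP (mon (q * k) \in msupp P)) => in_supp.
    rewrite (bigD1_seq (mon (q * k))) ?msupp_uniq //= mcoeffZ mdeg_mon.
    rewrite big_seq_cond big1 ?addr0 // => m /andP[mP m_neq].
    by rewrite mcoeffZ Fpow ?mulr0.
  rewrite (memN_msupp_eq0 in_supp) mul0r big_seq big1 // => m mP.
  by rewrite mcoeffZ Fpow ?mulr0 //; apply: contraNneq in_supp => <-.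
rewrite Phom ?Mdeg //.
pose Ydeg (m : 'X_{1..2}) := m (inord 1).
have YdegD : {morph Ydeg : a b / (a + b)%MM >-> (a + b)%N}.
  by move=> a b; rewrite /Ydeg mnmDE.
(* Every exponent of P exceeds q: q k does because k > 1, and the others are nonzero multiples of p
   q. *)
have PY0 : eqlow Ydeg q.+1 (P \mPo [tuple 'X_(inord 1)]) 0.
  rewrite comp_mpoly1E; apply: eqlow_sum0 => m mP.
  rewrite -[X in eqlow _ _ _ X](scaler0 _ P@_m); apply: eqlowZ.
  apply: (@eqlow_le _ _ _ (1 * mdeg m)).
    rewrite mul1n; have [->|m_neq] := eqVneq m (mon (q * k)).
      by rewrite mdeg_mon -{1}[q]muln1 ltn_pmul2l.
    by have [] := supp m mP m_neq.
  apply: (eqlowX0 YdegD) => a; rewrite /Ydeg ltnS leqn0 mcoeffX mcoeff0 => /eqP.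
  by case: eqP => // aE; rewrite -aE mnm1E eqxx.
set PX := P \mPo [tuple 'X_(inord 0)].
(* Since Y has exponent q in M, one may work modulo Y^(q+1), where P(Y) vanishes. What remains is
   F(P(X), 0) = P(X), in which Y does not occur. *)
have -> : (padd F PX (P \mPo [tuple 'X_(inord 1)]))@_M = (padd F PX 0)@_M.
  apply: (@eqlow_compr _ _ _ YdegD q.+1 _ F); last by rewrite /Ydeg M1.
  by apply: (forall_tnth2 (P := eqlow Ydeg q.+1)).
rewrite (padd0 F_fgl) ?Mdeg //; last first.
  apply: eqdeg1_comp => //.
  exact: (eqdeg1_tnth1 (@eqdegX1 R 2 _)).
rewrite /PX comp_mpoly1E raddf_sum big1 // => m _ /=.
rewrite mcoeffZ mpolyXn mcoeffX; case: eqP => [/mnmP/(_ (inord 1))|_].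
  rewrite M1 mulmnE mnm1E -val_eqE /= !inordK //= mul0n => q0.
  by rewrite -q0 in q_gt0.
by rewrite mulr0.
Qed.

End LeadingCoefficient.

Lemma scoef_fgl_nmul0 (R : comNzRingType) (F : series R 2) n :
  is_fgl F -> scoef (fgl_nmul F n.+1) 0 = 0.
Proof.
move=> F_fgl; have F0 := eqdeg1_fgl 0 F_fgl.
rewrite /scoef (approx_fgl_nmul n (@approx_strunc R 2 0 F) F0) ?mdeg_mon //.
by rewrite eqdeg1_pnmul ?mcoeff0 ?mdeg_mon.
Qed.

(** The truncation of F at degree d + 1 satisfies the axioms in all degrees up to d, so [pnmul_padd]
    applies there; P agrees with the multiplication in the same degrees. *)
Lemma strunc_nmul_endo (R : comNzRingType) (F : series R 2) p d
    (P := strunc d (fgl_nmul F p.+1)) (Fd := strunc d.+1 F) :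
    is_fgl F ->
  eqdeg d.+1 (P \mPo [tuple Fd])
    (padd Fd (P \mPo [tuple 'X_(inord 0)]) (P \mPo [tuple 'X_(inord 1)])).
Proof.
move=> F_fgl.
have F0 : eqdeg 1 Fd 0 by apply: eqdeg1_fgl.
have Fd_fgl : fgl_upto d.+1 Fd by apply: fgl_upto_strunc.
have PP : eqdeg d.+1 P (pnmul Fd p).
  apply: (@approx_eqdeg _ _ _ (fgl_nmul F p.+1) (fgl_nmul F p.+1)) => //.
    exact: approx_strunc.
  by apply: approx_fgl_nmul => //; apply: approx_strunc_pred.
have X0 i := @eqdegX1 R 2 i.
have PPc (Q : {mpoly R[2]}) : eqdeg 1 Q 0 ->
    eqdeg d.+1 (P \mPo [tuple Q]) (pnmul Fd p \mPo [tuple Q]).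
  move=> Q0; apply: eqdeg_comp => //.
  exact: eqdeg1_tnth1.
apply: eqlow_trans (PPc _ F0) _.
apply: eqlow_trans (eqlow_sym (eqdeg_padd _ (PPc _ (X0 _)) (PPc _ (X0 _)))).
have := pnmul_padd Fd_fgl p (X0 (inord 0)) (X0 (inord 1)).
suff -> : padd Fd 'X_(inord 0) 'X_(inord 1) = Fd by [].
rewrite -[RHS]comp_mpoly_id; congr (_ \mPo _).
apply: eq_from_tnth => -[[|[|//]] lt_i]; rewrite tnth_mktuple;
  by congr 'X_ _; apply: val_inj; rewrite /= inordK.
Qed.

Lemma height_leading_coef (R : idomainType) p h (F : series R 2) v :
    p \in [pchar R] -> is_fgl F -> fgl_height p F h ->
    first_nonzero_coef (fgl_nmul F p) v ->
  scoef (fgl_nmul F p) (p ^ h) = v /\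
  forall j, ~~ (p ^ h %| j)%N -> scoef (fgl_nmul F p) j = 0.
Proof.
move=> p_char F_fgl [/series_in_powerP Pq h_max] [n [Pn v_neq0 n_min]].
have p_prime := pcharf_prime p_char.
have p_gt0 := prime_gt0 p_prime.
have coef0 : scoef (fgl_nmul F p) 0 = 0.
  by rewrite -(prednK p_gt0) scoef_fgl_nmul0.
set q := (p ^ h)%N in Pq *; have q_gt0 : (0 < q)%N by rewrite expn_gt0 p_gt0.
have {}Pq := Pq q_gt0; split=> //.
have [t nE] : exists t, n = (t * q)%N.
  by apply/dvdnP; apply: contraTT v_neq0 => /Pq; rewrite Pn => ->; rewrite eqxx.
(* The case t = 0 is excluded because [p]_F has no constant term, and t = 1 is the claim. A larger t
   will contradict the maximality of h. *)
case: t nE => [|[|t]] nE.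
- by move: v_neq0; rewrite -Pn nE mul0n coef0 eqxx.
- by rewrite -Pn nE mul1n.
exfalso; suff /h_max : series_in_power (p ^ h.+1) (fgl_nmul F p).
  by rewrite ltnn.
apply/series_in_powerP; first by rewrite expn_gt0 p_gt0.
rewrite expnS -/q; elim/ltn_ind => j IHj ndvd.
have [/dvdnP[k jE]|] := boolP (q %| j)%N; last exact: Pq.
(* The index 0 is divisible by p q, and the index q lies below n, which is at least 2 q; there
   remains k > 1. *)
case: k jE => [|[|k]] jE; first by rewrite jE mul0n dvdn0 in ndvd.
  by apply: n_min; rewrite jE nE ltn_pmul2r.
move: jE; rewrite mulnC; move: k.+2 (isT : 1 < k.+2)%N => {}k k_gt1 jE.
pose P := strunc (q * k) (fgl_nmul F p).
have P0 : eqdeg 1 P 0.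
  move=> m; rewrite ltnS leqn0 mcoeff_strunc mcoeff0 => /eqP m0.
  by rewrite m0 leq0n -(mon_mdeg m) m0; apply: coef0.
have q_nat : [pchar R].-nat q by rewrite pnatX pnatE // p_char.
have Phom := @strunc_nmul_endo R F p.-1 (q * k) F_fgl.
rewrite prednK // in Phom.
have Fd_fgl := fgl_upto_strunc (q * k).+1 F_fgl.
have := endo_coef_mulrn p_char q_nat k_gt1 Fd_fgl P0 Phom.
rewrite mcoeff_strunc mdeg_mon leqnn -jE => Pk.
(* The induction hypothesis supplies the support condition of [endo_coef_mulrn] for the truncation
   at degree j = q k. *)
have /eqP : scoef (fgl_nmul F p) j * k%:R = 0.
  rewrite mulr_natr; apply: Pk => m.
  rewrite mcoeff_strunc mdeg_mon -jE; case: leqP; last by rewrite eqxx.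
  move=> le_mj Pm m_neq; apply: contraNT Pm => ndvd_m.
  by apply/eqP; apply: IHj => //; rewrite ltn_neqAle m_neq.
(* In a domain either the coefficient is 0 or k is 0 in R. The latter means p divides k, so p q
   would divide j. *)
rewrite mulf_eq0 => /orP[/eqP //|]; rewrite -(dvdn_pcharf p_char).
case/dvdnP => l kE; case/negP: ndvd.
by rewrite jE kE mulnCA dvdn_mull // mulnC.
Qed.

(** * Effect of the coefficient of tau^i *)

Lemma mon_mulrn j k : (mon j *+ k)%MM = mon (j * k).
Proof. by apply/mnmP => l; rewrite mulmnE !mnmE mulnC. Qed.

Lemma eqdegXn (R : comNzRingType) k : eqdeg k ('X_[mon k] : {mpoly R[1]}) 0.
Proof.
move=> m lt_m; rewrite mcoeffX mcoeff0; case: eqP => // mE.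
by rewrite -mE mdeg_mon ltnn in lt_m.
Qed.

Section Comparison.
Variables (R : comNzRingType) (q i : nat).
Hypotheses (q_nat : [pchar R].-nat q) (i_gt0 : (0 < i)%N).
Variables (U V : {mpoly R[1]}) (u : R).
Hypotheses (V0 : eqdeg 1 V 0) (UV : eqdeg i.+1 U (V + u *: 'X_[mon i])).

Let q_gt0 : (0 < q)%N. Proof. by case/andP: q_nat. Qed.

Let U0 : eqdeg 1 U 0.
Proof.
apply: eqlow_trans (eqlow_le _ UV) _ => //.
rewrite -[X in eqlow _ _ _ X]addr0; apply: eqlowD => //.
rewrite -[X in eqlow _ _ _ X](scaler0 _ u); apply: eqlowZ.
exact: eqlow_le i_gt0 (@eqdegXn R i).
Qed.

(** U - V - u tau^i has order at least i + 1 and P has order at least q, so after substitution the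
    difference starts in degree q (i + 1). The term u P^i contributes u v^i. *)
Lemma mcoeff_comp_inner (P : {mpoly R[1]}) v :
    eqdeg q.+1 P (v *: 'X_[mon q]) ->
  (U \mPo [tuple P])@_(mon (q * i)) =
  (V \mPo [tuple P])@_(mon (q * i)) + v ^+ i * u.
Proof.
move=> Pv.
have P0 : eqdeg q P 0.
  apply: eqlow_trans (eqlow_le (leqnSn q) Pv) _.
  by rewrite -(scaler0 _ v); apply/eqlowZ/eqdegXn.
have UVP : eqdeg (q * i.+1) ((U - (V + u *: 'X_[mon i])) \mPo [tuple P]) 0.
  apply: eqlow_compl0; first exact: mdegD.
    by move=> m lt_m; rewrite mcoeffB UV // subrr.
  exact: (forall_tnth1 (P := fun x _ => eqdeg q x 0) (a' := tt)).
have /UVP : (mdeg (mon (q * i)) < q * i.+1)%N by rewrite mdeg_mon ltn_pmul2l.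
rewrite comp_mpolyB mcoeffB mcoeff0 => /subr0_eq ->.
rewrite comp_mpolyD mcoeffD comp_mpolyZ mcoeffZ; congr (_ + _).
rewrite comp_mpolyX big_ord1 mnmE.
rewrite (eqdeg_exp (k := i) P0 Pv) ?mdeg_mon // exprZn mpolyXn mon_mulrn.
by rewrite mcoeffZ mcoeffX eqxx mulr1 mulrC.
Qed.

(** By additivity, U^q - V^q - u^q tau^(q i) is the q-th power of U - V - u tau^i, of order at least
    q (i + 1). *)
Lemma eqdeg_Frobenius :
  eqdeg (q * i).+1 (U ^+ q - V ^+ q) (u ^+ q *: 'X_[mon (q * i)]).
Proof.
have char_nat := pnat_pchar_mpoly 1 q_nat.
have UVq : eqdeg (i.+1 * q) ((U - (V + u *: 'X_[mon i])) ^+ q) 0.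
  by apply: (eqlowX0 (@mdegD 1)); apply: (iffLR (eqlow_sub _ _ _ _) UV).
move: UVq; rewrite exprDn_pchar // exprNn_pchar // exprDn_pchar //.
rewrite exprZn mpolyXn mon_mulrn mulnC (mulnC i) => UVq.
apply/eqlow_sub; rewrite -addrA -opprD; apply: eqlow_le UVq.
by rewrite ltn_pmul2l.
Qed.

(** U^q - V^q divides the difference and already has order at least q i; for k > 1 the cofactor has
    no constant term. *)
Lemma mcoeff_sub_exp k : (1 < k)%N ->
  ((U ^+ q) ^+ k - (V ^+ q) ^+ k)@_(mon (q * i)) = 0.
Proof.
move=> k_gt1; have dD := @mdegD 1.
have d0 : eqdeg (q * i) (U ^+ q - V ^+ q) 0.
  apply: eqlow_trans (eqlow_le (leqnSn _) eqdeg_Frobenius) _.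
  by rewrite -(scaler0 _ (u ^+ q)); apply/eqlowZ/eqdegXn.
rewrite subrXX -(mcoeff0 R (mon (q * i))).
apply: (eqlowM0 dD d0 (e := 1)); last by rewrite mdeg_mon addn1.
apply: eqlow_sum0 => l _.
apply: (@eqlow_le _ _ _ (q * (k.-1 - l) + q * l)).
  rewrite -mulnDr subnK; first by rewrite muln_gt0 q_gt0 -subn1 subn_gt0.
  by rewrite -ltnS prednK // ltnW.
apply: (eqlowM0 dD); rewrite -exprM -[X in eqlow _ X]mul1n; exact: eqlowX0.
Qed.

(** Term by term in P: exponents above q i do not reach tau^(q i), those not divisible by q have
    coefficient 0, and multiples q k with k > 1 are handled by [mcoeff_sub_exp]. Only the exponent q
    is left. *)
Lemma mcoeff_comp_outer (P : {mpoly R[1]}) :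
    (forall j, (j <= q * i)%N -> ~~ (q %| j)%N -> P@_(mon j) = 0) ->
  (P \mPo [tuple U])@_(mon (q * i)) =
  (P \mPo [tuple V])@_(mon (q * i)) + P@_(mon q) * u ^+ q.
Proof.
move=> Pq; apply/eqP; rewrite addrC -subr_eq -mcoeffB !comp_mpoly1E -sumrB.
have dD := @mdegD 1.
have term m : (P@_m *: U ^+ mdeg m - P@_m *: V ^+ mdeg m)@_(mon (q * i)) =
    P@_m * ((mdeg m == q)%:R * u ^+ q).
  rewrite -scalerBr mcoeffZ.
  have [le_m|lt_m] := leqP (mdeg m) (q * i); last first.
    rewrite gtn_eqF ?mul0r; last first.
      by apply: leq_ltn_trans lt_m; rewrite leq_pmulr.
    rewrite mcoeffB (eqlowX0 dD (k := mdeg m) U0) ?mdeg_mon ?mul1n //.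
    rewrite (eqlowX0 dD (k := mdeg m) V0) ?mdeg_mon ?mul1n //.
    by rewrite mcoeff0 subrr mulr0.
  have [/dvdnP[k mE]|ndvd] := boolP (q %| mdeg m)%N; last first.
    by rewrite -(mon_mdeg m) Pq // !mul0r.
  congr (_ * _); rewrite {}mE {le_m} (mulnC k) !exprM.
  rewrite -[X in _ == X]muln1 eqn_pmul2l //.
  case: k => [|[|k]].
  - by rewrite !expr0 subrr mcoeff0 mul0r.
  - by rewrite !expr1 eqdeg_Frobenius ?mdeg_mon // mcoeffZ mcoeffX eqxx mulrC.
  by rewrite mul0r mcoeff_sub_exp.
rewrite raddf_sum /= (eq_bigr _ (fun m _ => term m)).
case: (boolP (mon q \in msupp P)) => in_supp.
  rewrite (bigD1_seq (mon q)) ?msupp_uniq //= mdeg_mon eqxx mul1r.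
  rewrite big1 ?addr0 // => m; rewrite -{1}(mon_mdeg m) eq_mon => /negbTE ->.
  by rewrite mul0r mulr0.
rewrite (memN_msupp_eq0 in_supp) mul0r big_seq big1 // => m mP.
case: eqP => [mq|_]; last by rewrite mul0r mulr0.
by rewrite -mq mon_mdeg mP in in_supp.
Qed.

End Comparison.

(** * The universal polynomial *)

Section UniversalPolynomial.
Variables (p i d : nat).

Let A := {mpoly 'F_p[#|cvars i d|]}.
Let var (x : cvars i d) : A := 'X_(enum_rank x).

Definition hom_generic : {mpoly A[1]} :=
  \sum_(j < i) var (inl (inl j)) *: 'X_[mon j].

Definition fgl_generic : {mpoly A[2]} :=
  \sum_(m : 'X_{1..2 < d.+1}) var (inl (inr m)) *: 'X_[m].

Definition fgl_generic' : {mpoly A[2]} :=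
  \sum_(m : 'X_{1..2 < d.+1}) var (inr m) *: 'X_[m].

Definition universal_poly : A :=
  (hom_generic \mPo [tuple pnmul fgl_generic p.-1])@_(mon d) -
  (pnmul fgl_generic' p.-1 \mPo [tuple hom_generic])@_(mon d).

End UniversalPolynomial.

Lemma map_pnmul (R S : comNzRingType) (phi : {rmorphism R -> S}) F n :
  map_mpoly phi (pnmul F n) = pnmul (map_mpoly phi F) n.
Proof.
elim: n => [|n IHn] /=; first exact: map_mpolyX.
rewrite /padd map_mpoly_comp_mpoly; congr (_ \mPo _).
by apply: eq_from_tnth => -[[|[|//]] lt_i]; rewrite tnth_mktuple //= map_mpolyX.
Qed.

(** The polynomial is built from its variables by ring operations and substitutions, all compatible
    with ring morphisms; it suffices to specialize the generic series. *)
Lemma rmorph_universal_poly p i d (R : comNzRingType)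
    (phi : {rmorphism {mpoly 'F_p[#|cvars i d|]} -> R})
    (U : series R 1) (F F' : series R 2)
    (V := \sum_(j < i) scoef U j *: 'X_[mon j] : {mpoly R[1]}) :
    (forall x, phi 'X_(enum_rank x) = cvars_val U F F' x) ->
  phi (universal_poly p i d) =
  (V \mPo [tuple pnmul (strunc d F) p.-1])@_(mon d) -
  (pnmul (strunc d F') p.-1 \mPo [tuple V])@_(mon d).
Proof.
move=> phi_var.
have mapU : map_mpoly phi (hom_generic p i d) = V.
  rewrite raddf_sum; apply: eq_bigr => j _ /=.
  by rewrite map_mpolyZ map_mpolyX phi_var.
have mapF : map_mpoly phi (fgl_generic p i d) = strunc d F.
  rewrite raddf_sum; apply: eq_bigr => m _ /=.
  by rewrite map_mpolyZ map_mpolyX phi_var.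
have mapF' : map_mpoly phi (fgl_generic' p i d) = strunc d F'.
  rewrite raddf_sum; apply: eq_bigr => m _ /=.
  by rewrite map_mpolyZ map_mpolyX phi_var.
have map1 (P Q : {mpoly {mpoly 'F_p[#|cvars i d|]}[1]}) :
    map_mpoly phi (P \mPo [tuple Q]) =
    map_mpoly phi P \mPo [tuple map_mpoly phi Q].
  rewrite map_mpoly_comp_mpoly; congr (_ \mPo _).
  by apply: eq_from_tnth => j; rewrite tnth_mktuple ord1.
rewrite /universal_poly [LHS]rmorphB; congr (_ - _).
  apply: etrans (esym (mcoeff_map_mpoly phi _ _)) _.
  by rewrite map1 map_pnmul mapU mapF.
apply: etrans (esym (mcoeff_map_mpoly phi _ _)) _.
by rewrite map1 map_pnmul mapU mapF'.
Qed.

(** * Evaluation of polynomials over F_p in a ring of characteristic p *)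

Section EvalFp.
Variables (p : nat) (R : comNzRingType).

(** The map is a ring morphism only in characteristic p; carrying [p_char] as an argument lets the
    morphism structures be attached to [Fp_natr p_char]. *)
Definition Fp_natr (p_char : p \in [pchar R]) (x : 'F_p) : R := (x : nat)%:R.

Variable p_char : p \in [pchar R].

Let natr_val n : ((n%:R : 'F_p) : nat)%:R = n%:R :> R.
Proof.
by rewrite val_Fp_nat ?(GRing.natr_mod_pchar p_char) ?(pcharf_prime p_char).
Qed.

Lemma Fp_natr_is_nmod_morphism : nmod_morphism (Fp_natr p_char).
Proof.
split=> // x y; rewrite /Fp_natr -[in LHS](natr_Zp x) -[in LHS](natr_Zp y).
by rewrite -natrD natr_val natrD.
Qed.

Lemma Fp_natr_is_monoid_morphism : monoid_morphism (Fp_natr p_char).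
Proof.
split=> [|x y]; first exact: (natr_val 1).
rewrite /Fp_natr -[in LHS](natr_Zp x) -[in LHS](natr_Zp y).
by rewrite -natrM natr_val natrM.
Qed.

HB.instance Definition _ :=
  GRing.isNmodMorphism.Build _ _ (Fp_natr p_char) Fp_natr_is_nmod_morphism.
HB.instance Definition _ :=
  GRing.isMonoidMorphism.Build _ _ (Fp_natr p_char) Fp_natr_is_monoid_morphism.

Lemma Fp_eval_universal_poly i d (U : series R 1) (F F' : series R 2) :
  let V := \sum_(j < i) scoef U j *: 'X_[mon j] : {mpoly R[1]} in
  Fp_eval (universal_poly p i d) (cvars_val U F F') =
  (V \mPo [tuple pnmul (strunc d F) p.-1])@_(mon d) -
  (pnmul (strunc d F') p.-1 \mPo [tuple V])@_(mon d).
Proof.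
(* [Fp_eval] unfolds to this [mmap], whose coefficient map is now a ring morphism. *)
apply: (@rmorph_universal_poly p i d _ (mmap (Fp_natr p_char)
  (fun k : 'I_#|cvars i d| => cvars_val U F F' (enum_val k)))) => x.
by rewrite [LHS]mmapX mmap1U enum_rankK.
Qed.

End EvalFp.

(** * Comparison of U with its part of degree below i *)

Theorem theorem7p2 (p h q i : nat) (p_prime : prime p) (h_gt0 : (0 < h)%N)
    (q_def : q = (p ^ h)%N) (i_pow : exists s : nat, i = (p ^ s)%N) :
  exists C : {mpoly 'F_p[#|cvars i (q * i)|]},
    forall (R : idomainType) (charRp : p \in [pchar R])
           (F F' : series R 2) (U : series R 1) (v1 v1' : R),
      is_fgl F -> is_fgl F' ->
      fgl_height p F h -> fgl_height p F' h ->
      is_fgl_hom F F' U ->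
      first_nonzero_coef (fgl_nmul F p) v1 ->
      first_nonzero_coef (fgl_nmul F' p) v1' ->
      v1' * scoef U i ^+ q - v1 ^+ i * scoef U i =
      Fp_eval C (cvars_val U F F').
Proof.
have p_gt0 := prime_gt0 p_prime.
have i_gt0 : (0 < i)%N by case: i_pow => s ->; rewrite expn_gt0 p_gt0.
exists (universal_poly p i (q * i)).
move=> R charRp F F' U v1 v1' F_fgl F'_fgl hF hF' [U0 Uhom] Fv F'v.
have q_nat : [pchar R].-nat q by rewrite q_def pnatX pnatE // charRp.
have q_gt0 : (0 < q)%N by case/andP: q_nat.
have [coefF F_q] := height_leading_coef charRp F_fgl hF Fv.
have [coefF' F'_q] := height_leading_coef charRp F'_fgl hF' F'v.
rewrite -q_def in coefF F_q coefF' F'_q.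
rewrite (Fp_eval_universal_poly charRp); set V := \sum_(j < i) _.
set d := (q * i)%N.
set P := pnmul (strunc d F) p.-1; set P' := pnmul (strunc d F') p.-1.
pose Up := strunc d U.
have le_qd : (q <= d)%N by rewrite leq_pmulr.
have le_id : (i <= d)%N by rewrite leq_pmull.
have F0 := eqdeg1_fgl d F_fgl; have F'0 := eqdeg1_fgl d F'_fgl.
have coefP (G : series R 2) j : is_fgl G -> (j <= d)%N ->
    (pnmul (strunc d G) p.-1)@_(mon j) = scoef (fgl_nmul G p) j.
  move=> G_fgl le_j; rewrite /scoef -{2}(prednK p_gt0).
  rewrite (approx_fgl_nmul _ (@approx_strunc R 2 d G) (eqdeg1_fgl d G_fgl)) //.
  by rewrite mdeg_mon.
have coefV j : V@_(mon j) = if (j < i)%N then scoef U j else 0.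
  rewrite /V raddf_sum /=; case: ltnP => [lt_j|le_j].
    rewrite (bigD1 (Ordinal lt_j)) //= big1 => [|k /negbTE k_neq].
      by rewrite mcoeffZ mcoeffX eqxx mulr1 addr0.
    by rewrite mcoeffZ mcoeffX eq_mon [k == j :> nat]k_neq mulr0.
  rewrite big1 // => k _; rewrite mcoeffZ mcoeffX eq_mon.
  by rewrite ltn_eqF ?mulr0 // (leq_trans _ le_j).
have V0 : eqdeg 1 V 0.
  move=> m; rewrite ltnS leqn0 -{2}(mon_mdeg m) => /eqP ->.
  by rewrite coefV i_gt0 U0 mcoeff0.
have Up0 : eqdeg 1 Up 0.
  move=> m; rewrite ltnS leqn0 -{2}(mon_mdeg m) => /eqP ->.
  by rewrite mcoeff_strunc mdeg_mon mcoeff0; exact: U0.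
have UV : eqdeg i.+1 Up (V + scoef U i *: 'X_[mon i]).
  move=> m; rewrite ltnS -{2 3}(mon_mdeg m); set j := mdeg m => le_j.
  rewrite mcoeff_strunc mdeg_mon (leq_trans le_j le_id) mcoeffD coefV mcoeffZ.
  rewrite mcoeffX eq_mon; move: le_j; rewrite leq_eqVlt => /orP[/eqP ->|lt_j].
    by rewrite ltnn add0r eqxx mulr1.
  by rewrite lt_j gtn_eqF // mulr0 addr0.
have Pv : eqdeg q.+1 P (v1 *: 'X_[mon q]).
  move=> m; rewrite ltnS -{2 3}(mon_mdeg m); set j := mdeg m => le_j.
  rewrite coefP // ?(leq_trans le_j) // mcoeffZ mcoeffX eq_mon.
  case: eqP => [<-|/eqP j_neq]; first by rewrite coefF mulr1.
  rewrite mulr0.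
  (* As q divides 0, [F_q] does not cover the constant term, which vanishes separately. *)
  have [->|j_gt0] := posnP j; first by rewrite -(prednK p_gt0) scoef_fgl_nmul0.
  by apply: F_q; rewrite gtnNdvd // ltn_neqAle eq_sym j_neq.
(* The identity U([p]_F) = [p]_F'(U) at tau^d, read on truncations at degree d. *)
have UPP : (Up \mPo [tuple P])@_(mon d) = (P' \mPo [tuple Up])@_(mon d).
  apply: (@pnmul_hom R d.+1 _ _ _ _ F0 F'0 Up0); last by rewrite mdeg_mon.
  have UpA := @approx_strunc R 1 d U.
  have comp1 (f : series R 2) Q : approx d.+1 f Q -> eqdeg 1 Q 0 ->
      approx d.+1 (scomp U [tuple f]) (Up \mPo [tuple Q]).
    move=> fQ Q0; apply: approx_scomp => //.
      exact: (forall_tnth1 (P := approx d.+1)).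
    exact: eqdeg1_tnth1.
  have X0 k := @eqdegX1 R 2 k; have XA k := @approx_svar R 2 d.+1 k.
  have UX0 (k : 'I_2) : eqdeg 1 (Up \mPo [tuple 'X_k]) 0.
    exact: eqdeg1_comp Up0 (eqdeg1_tnth1 (X0 k)).
  have UXA (k : 'I_2) := comp1 _ _ (XA k) (X0 k).
  apply: approx_eqdeg Uhom; first exact: comp1 (@approx_strunc R 2 d F) F0.
  exact: approx_padd (@approx_strunc R 2 d F') (UXA _) (UXA _) (UX0 _) (UX0 _).
have P'q j : (j <= d)%N -> ~~ (q %| j)%N -> P'@_(mon j) = 0.
  by move=> le_j ndvd; rewrite coefP // F'_q.
have P'v : P'@_(mon q) = v1' by rewrite coefP.
clearbody V P P' Up.
(* At tau^d the identity becomes V([p]_F) + v_1^i u_i = [p]_F'(V) + v'_1 u_i^q; the claim is a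
   rearrangement. *)
move: UPP; rewrite (mcoeff_comp_inner q_nat UV Pv).
rewrite (mcoeff_comp_outer q_nat i_gt0 V0 UV P'q) P'v => E.
by apply/eqP; rewrite subr_eq addrAC eq_sym subr_eq E addrC.
Qed.
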